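(* Let $1<p<\infty$ and let $q$ be defined by $1/p+1/q=1$. Every Dirichlet series $f\in\mathcal{H}(ces_p)$ converges, in fact absolutely, on the vertical half-plane $\mathbb{C}_{1/q}$. Moreover, the value $1/q$ cannot be improved, that is, $$\sigma_c(\mathcal{H}(ces_p))=\sigma_a(\mathcal{H}(ces_p))=1/q.$$ Consequently, $\mathcal{H}(ces_p)$ is a Banach space of analytic functions on $\mathbb{C}_{1/q}$, which is a maximal domain (no half-plane $\mathbb{C}_\sigma$ with $\sigma<1/q$ is a common half-plane of convergence for all $f\in\mathcal{H}(ces_p)$).
   Context: For $\theta\in\mathbb{R}$, $\mathbb{C}_\theta:=\{s\in\mathbb{C}:\Re(s)>\theta\}$. For $1<p<\infty$, the Ces\`aro sequence space $ces_p$ consists of all complex sequences $(a_n)_{n=1}^\infty$ with $$\|(a_n)_{n=1}^\infty\|_{ces_p}:=\Big(\sum_{n=1}^\infty\Big(\frac1n\sum_{k=1}^n|a_k|\Big)^p\Big)^{1/p}<\infty.$$ $\mathcal{H}(ces_p)$ is the space of all Dirichlet series $f(s)=\sum_{n=1}^\infty a_nn^{-s}$ with $(a_n)_{n=1}^\infty\in ces_p$, with norm $\|f\|_{\mathcal{H}(ces_p)}:=\|(a_n)_{n=1}^\infty\|_{ces_p}$; it is a Banach space, linearly isometric to $ces_p$. For a Dirichlet series $f$, $\sigma_c(f)$ (resp. $\sigma_a(f)$) is the abscissa of convergence (resp. absolute convergence), i.e. the infimum of all $\sigma\in\mathbb{R}$ such that the series converges (resp. converges absolutely) on $\mathbb{C}_\sigma$.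 For a space $\mathcal{E}$ of Dirichlet series, $\sigma_c(\mathcal{E}):=\sup\{\sigma_c(f):f\in\mathcal{E}\}$ and $\sigma_a(\mathcal{E}):=\sup\{\sigma_a(f):f\in\mathcal{E}\}$. *)

(* Defs.v *)
From HB Require Import structures.
From mathcomp Require Import all_boot all_order all_algebra.
From mathcomp Require Import all_classical all_reals all_analysis.
From mathcomp Require Export complex.

Set Implicit Arguments.
Unset Strict Implicit.
Unset Printing Implicit Defensive.

Import Order.TTheory GRing.Theory Num.Theory.
Import numFieldNormedType.Exports.

Local Open Scope classical_set_scope.
Local Open Scope ring_scope.
Local Open Scope complex_scope.

(* The usual topology of the modulus on the complex numbers. *)
HB.instance Definition _ (R : rcfType) := NormedModule.copy R[i] (R[i]^o).

(* Sequences (a_n)_{n >= 1} are shifted: [a n] stands for a_{n+1}.  A (formal)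
   Dirichlet series is represented by its sequence of coefficients, so that
   H(ces_p) and ces_p share the same underlying set and norm. *)

Section ces.
Variable R : realType.
Implicit Types (p : R) (a : nat -> R[i]).

Definition ces_norm p a : \bar R :=
  poweR (\sum_(0 <= n <oo)
    (powR (n.+1%:R^-1 * \sum_(k < n.+1) Normc.normc (a k)) p)%:E)%E p^-1.

Definition ces p : set (nat -> R[i]) := [set a | (ces_norm p a < +oo)%E].

End ces.

Section dirichlet.
Variable R : realType.
Implicit Types (a : nat -> R[i]) (s : R[i]) (E : set (nat -> R[i])).

Definition half_plane (theta : R) : set R[i] :=
  [set s | theta < complex.Re s].

Definition cexp (z : R[i]) : R[i] :=
  (expR (complex.Re z))%:C * (cos (complex.Im z) +i* sin (complex.Im z)).

(* m^(-s) = exp (- s ln m), with m = n.+1 because of the shift. *)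
Definition dirichlet_term a s (n : nat) : R[i] :=
  a n * cexp (- s * (ln (n.+1%:R : R))%:C).

Definition dirichlet_cvg a s : Prop := cvgn (series (dirichlet_term a s)).

Definition dirichlet_abs_cvg a s : Prop :=
  cvgn [normed series (dirichlet_term a s)].

Definition dirichlet_sum a s : R[i] := limn (series (dirichlet_term a s)).

Definition sigma_c a : \bar R :=
  ereal_inf [set sigma%:E | sigma in
    [set sigma : R | forall s, half_plane sigma s -> dirichlet_cvg a s]].

Definition sigma_a a : \bar R :=
  ereal_inf [set sigma%:E | sigma in
    [set sigma : R | forall s, half_plane sigma s -> dirichlet_abs_cvg a s]].

Definition space_sigma_c E : \bar R := ereal_sup [set sigma_c a | a in E].

Definition space_sigma_a E : \bar R := ereal_sup [set sigma_a a | a in E].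

End dirichlet.

Section banach.
Variable R : realType.

Definition analytic_on (Omega : set R[i]) (f : R[i] -> R[i]) : Prop :=
  forall z, Omega z -> exists c : nat -> R[i],
    \forall w \near z, [series c k * (w - z) ^+ k]_k @ \oo --> f w.

(* The set [E] of Dirichlet series, with norm [N], is a Banach space of
   analytic functions on [Omega]: a complex Banach space [V] is identified both
   with [E] (isometrically, through [coef]) and, pointwise operations included,
   with a space of functions on [Omega] (through [ev], functions on [Omega]
   being extended by 0), the function attached to a series being its sum. *)
Definition banach_space_of_analytic_functions (Omega : set R[i])
    (E : set (nat -> R[i])) (N : (nat -> R[i]) -> \bar R) : Prop :=
  exists (V : completeNormedModType R[i])
         (coef : {linear V -> (nat -> R[i])})
         (ev : {linear V -> (R[i] -> R[i])}),
    [/\ injective coef, range coef = E,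
        forall f, N (coef f) = (complex.Re `|f|)%:E,
        injective ev &
        forall f, ev f = patch (fun=> 0) Omega (dirichlet_sum (coef f))
                  /\ analytic_on Omega (ev f)].

End banach.

(* Main.v *)
(* If A_N is the sum of |a_n| over n <= N, the means A_n / n with N < n <= 2N
   are all at least A_N / (2N), so membership in ces_p forces
   A_N = O(N^(1 - 1/p)); summing |a_n| n^(-x) over dyadic blocks then gives a
   geometric series for every x > 1 - 1/p = 1/q.  Conversely, the lacunary
   series with coefficient 2^(j t) at 2^j, for 0 < t < 1/q, lies in ces_p, and
   its terms at s = t do not tend to 0.  The sums are analytic because, near z,
   expanding n^(-(w - z)) in powers of w - z gives an absolutely convergent
   double series; they determine the coefficients because the first nonzero
   coefficient dominates the series as s goes to infinity along the reals. *)

From HB Require Import structures.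
Require Import Defs.
From mathcomp Require Import all_boot all_order all_algebra.
From mathcomp Require Import all_classical all_reals all_analysis.
From mathcomp Require Import ring lra.

Set Implicit Arguments.
Unset Strict Implicit.
Unset Printing Implicit Defensive.

Import Order.TTheory GRing.Theory Num.Theory.
Import numFieldNormedType.Exports.

Local Open Scope classical_set_scope.
Local Open Scope ring_scope.
Local Open Scope complex_scope.

Local Notation normc := Normc.normc.

(** * Complex series *)

Section complex_convergence.
Variable R : realType.
Implicit Types (x y : R) (z w : R[i]) (u : nat -> R[i]).

Lemma normcD z w : normc (z + w) <= normc z + normc w.
Proof. exact: le_normcD. Qed.

Lemma normc_ge0 z : 0 <= normc z.
Proof. by case: z => a b; rewrite sqrtr_ge0. Qed.

Lemma normcB z w : normc (z - w) = normc (w - z).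
Proof. by rewrite -normcN opprB. Qed.

Lemma normc_real x : normc x%:C = `|x|.
Proof. by rewrite /= expr0n/= addr0 sqrtr_sqr. Qed.

Lemma normcX z n : normc (z ^+ n) = normc z ^+ n.
Proof.
elim: n => [|n IH]; first by rewrite !expr0 Normc.normc1.
by rewrite !exprS Normc.normcM IH.
Qed.

Lemma normc_sum (I : Type) (r : seq I) (P : pred I) (F : I -> R[i]) :
  normc (\sum_(i <- r | P i) F i) <= \sum_(i <- r | P i) normc (F i).
Proof.
elim/big_ind2 : _ => [|w x z y wx zy|i _]; rewrite ?Normc.normc0//.
by rewrite (le_trans (normcD _ _))// lerD.
Qed.

Lemma normc_ge_absRe z : `|complex.Re z| <= normc z.
Proof. by rewrite -lecR; exact: normc_ge_Re. Qed.

Lemma normc_ge_absIm z : `|complex.Im z| <= normc z.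
Proof.
by case: z => a b /=; rewrite -sqrtr_sqr ler_wsqrtr// lerDr sqr_ge0.
Qed.

Lemma normc_le_ReIm z : normc z <= `|complex.Re z| + `|complex.Im z|.
Proof.
case: z => a b /=; rewrite -(ler_pXn2r (ltn0Sn 1)) ?nnegrE ?sqrtr_ge0
  ?addr_ge0//.
by rewrite sqr_sqrtr ?addr_ge0 ?sqr_ge0// sqrrD !real_normK ?num_real// addrAC
  lerDl mulrn_wge0 ?mulr_ge0.
Qed.

(** In the order of [R[i]] a positive element has imaginary part 0, so the complex radii of the
    normed module are real ones; this allows estimates with real [e] throughout. *)
Lemma cvg_normcP (T : Type) (F : set_system T) {FF : Filter F}
    (f : T -> R[i]) z :
  f @ F --> z <-> forall e : R, 0 < e -> \forall t \near F, normc (z - f t) < e.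
Proof.
split=> [/cvgrPdist_lt fz e e0|fz].
  have := fz e%:C; rewrite ltcR => /(_ e0).
  by apply: filterS => t; rewrite -ltcR.
apply/cvgrPdist_lt => e e0.
have /andP[/eqP Im0 Re0] : (complex.Im e == 0) && (0 < complex.Re e).
  by move: e0; rewrite ltcE /=.
apply: filterS (fz _ Re0) => t; rewrite -ltcR.
by case: e Im0 {e0 Re0} => a b /= ->.
Qed.

Lemma ReD z w : complex.Re (z + w) = complex.Re z + complex.Re w.
Proof. by case: z w => a b [c d]. Qed.

Lemma ImD z w : complex.Im (z + w) = complex.Im z + complex.Im w.
Proof. by case: z w => a b [c d]. Qed.

Lemma ReB z w : complex.Re (z - w) = complex.Re z - complex.Re w.
Proof. by case: z w => a b [c d]. Qed.

Lemma ImB z w : complex.Im (z - w) = complex.Im z - complex.Im w.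
Proof. by case: z w => a b [c d]. Qed.

Lemma cvg_complex (T : Type) (F : set_system T) {FF : Filter F}
    (f : T -> R[i]) z :
  (fun t => complex.Re (f t)) @ F --> complex.Re z ->
  (fun t => complex.Im (f t)) @ F --> complex.Im z -> f @ F --> z.
Proof.
move=> /cvgrPdist_lt fre /cvgrPdist_lt fim; apply/cvg_normcP => e e0.
have e20 : 0 < e / 2 by rewrite divr_gt0.
near=> t.
rewrite (le_lt_trans (normc_le_ReIm _))// [ltRHS](splitr e) ltrD//.
  by rewrite ReB; near: t; exact: fre.
by rewrite ImB; near: t; exact: fim.
Unshelve. all: by end_near. Qed.

Lemma Re_sum (I : Type) (r : seq I) (P : pred I) (F : I -> R[i]) :
  complex.Re (\sum_(i <- r | P i) F i) = \sum_(i <- r | P i) complex.Re (F i).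
Proof. by apply: (big_morph _ ReD). Qed.

Lemma Im_sum (I : Type) (r : seq I) (P : pred I) (F : I -> R[i]) :
  complex.Im (\sum_(i <- r | P i) F i) = \sum_(i <- r | P i) complex.Im (F i).
Proof. by apply: (big_morph _ ImD). Qed.

Lemma cvg_real_complex (T : Type) (F : set_system T) {FF : Filter F}
    (f : T -> R) x : f @ F --> x -> (fun t => (f t)%:C) @ F --> x%:C.
Proof. by move=> fx; apply: cvg_complex => //=; exact: cvg_cst. Qed.

Lemma bounded_series_cvg (v : nat -> R) M : (forall n, 0 <= v n) ->
  (forall n, \sum_(k < n) v k <= M) -> cvgn (series v).
Proof.
move=> v0 vM; apply: nondecreasing_is_cvgn; first exact: nondecreasing_series.
by exists M => _ [n _ <-]; rewrite /series/= big_mkord.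
Qed.

(** The real and imaginary parts are dominated by the modulus, so both real series converge
    absolutely. *)
Lemma normc_series_cvg u M : (forall n, \sum_(k < n) normc (u k) <= M) ->
  cvgn (series u).
Proof.
move=> uM.
have part (f : R[i] -> R) : (forall z, `|f z| <= normc z) ->
    cvgn (series (f \o u)).
  move=> fz; apply: (@normed_cvg _ R^o).
  apply: (@bounded_series_cvg _ M) => n; first exact: normr_ge0.
  by rewrite (le_trans _ (uM n))// ler_sum// => i _; exact: fz.
have /cvg_ex[a ua] := part _ normc_ge_absRe.
have /cvg_ex[b ub] := part _ normc_ge_absIm.
apply/cvg_ex; exists (a +i* b); apply: cvg_complex.
  by under eq_fun do rewrite /series/= Re_sum.
by under eq_fun do rewrite /series/= Im_sum.
Qed.

Lemma normc_series_abs_cvg u M : (forall n, \sum_(k < n) normc (u k) <= M) ->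
  cvgn [normed series u].
Proof.
move=> uM; have /cvg_ex[a ua] : cvgn (series (fun n => normc (u n))).
  by apply: (bounded_series_cvg _ uM) => n; exact: normc_ge0.
apply/cvg_ex; exists a%:C.
rewrite (_ : [normed _] = fun n => (series (fun k => normc (u k)) n)%:C).
  exact: cvg_real_complex.
by apply/funext => n; rewrite /series/= rmorph_sum.
Qed.

Lemma cvg_series_normc u z e : series u @ \oo --> z -> 0 < e ->
  exists N, forall n, (N <= n)%N -> normc (z - \sum_(k < n) u k) < e.
Proof.
move=> /cvg_normcP uz e0; have [N _ HN] := uz _ e0.
by exists N => n Nn; have := HN n Nn; rewrite /series/= big_mkord.
Qed.

Lemma normc_sumB_le u (v : nat -> R) m n : (m <= n)%N ->
  (forall i, normc (u i) <= v i) ->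
  normc (\sum_(i < n) u i - \sum_(i < m) u i) <=
    \sum_(i < n) v i - \sum_(i < m) v i.
Proof.
move=> mn uv; rewrite -!(big_mkord xpredT).
rewrite !(big_cat_nat (leq0n m) mn)/= !(addrAC _ _ (- _)) !subrr !add0r.
by rewrite (le_trans (normc_sum _ _ _))// ler_sum.
Qed.

Lemma cvg_finsum (K : numFieldType) (V : normedModType K) (T : Type)
    (F : set_system T) {FF : Filter F} (I : Type) (r : seq I) (P : pred I)
    (f : I -> T -> V) (l : I -> V) : (forall i, P i -> f i @ F --> l i) ->
  (fun t => \sum_(i <- r | P i) f i t) @ F --> \sum_(i <- r | P i) l i.
Proof. by move=> fl; apply: cvg_big => //; exact: add_continuous. Qed.

(* All partial sums over large rectangles are close to one over a fixed
   rectangle, and so are both iterated sums. *)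
Lemma series_exchange (u : nat -> nat -> R[i]) (r c : nat -> R[i])
    (M : R) (L : R[i]) :
  (forall n k, \sum_(i < n) \sum_(j < k) normc (u i j) <= M) ->
  (forall i, series (u i) @ \oo --> r i) ->
  (forall j, series (fun i => u i j) @ \oo --> c j) ->
  series r @ \oo --> L -> series c @ \oo --> L.
Proof.
move=> uM ur uc rL.
pose S n k := \sum_(i < n) \sum_(j < k) u i j.
pose T n k := \sum_(i < n) \sum_(j < k) normc (u i j).
have ST n m k l : (n <= m)%N -> (k <= l)%N ->
    normc (S m l - S n k) <= T m l - T n k.
  (* The region between the two rectangles is cut at [S n l]: the rows from n to m over l columns,
     then the columns from k to l over n rows. *)
  move=> nm kl; rewrite -(subrK (S n l) (S m l)) -addrA.
  rewrite -[leRHS](subrKA (T n l)) (le_trans (normcD _ _))// lerD//.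
    apply: (@normc_sumB_le (fun i => \sum_(j < l) u i j)
      (fun i => \sum_(j < l) normc (u i j))) => // i.
    exact: normc_sum.
  rewrite /S /T -!sumrB (le_trans (normc_sum _ _ _))// ler_sum// => i _.
  exact: (@normc_sumB_le (u i) (fun j => normc (u i j))).
pose E := [set x | exists n k, x = T n k].
have supE : has_sup E.
  by split; [exists (T 0 0)%N; exists 0%N, 0%N | exists M => _ [n [k ->]];
    exact: uM].
(* The final error is one [d] from [L] to the sum of rows, and two each from the sums of rows and of
   columns to [S n0 k0]. *)
apply/cvg_normcP => e e0; pose d := e / 5.
have d0 : 0 < d by rewrite divr_gt0.
(* The rectangle n0 by k0 carries all of the absolute mass but less than [d], so enlarging it
   changes [S] by less than [d]. *)
have [_ [n0 [k0 ->]] Tsup] := sup_adherent d0 supE.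
have Snear n k : (n0 <= n)%N -> (k0 <= k)%N -> normc (S n k - S n0 k0) < d.
  move=> nn kk; rewrite (le_lt_trans (ST _ _ _ _ nn kk))// ltrBlDl.
  have : T n k <= sup E by apply: ub_le_sup; [case: supE | exists n, k].
  by move: Tsup; lra.
have lim_rows n : (n0 <= n)%N -> normc (\sum_(i < n) r i - S n0 k0) <= d + d.
  move=> nn.
  have : (fun k => S n k) @ \oo --> \sum_(i < n) r i.
    rewrite /S; apply: cvg_finsum => i _; apply: cvg_trans (ur i).
    by apply: near_eq_cvg; near=> k; rewrite /series/= big_mkord.
  move=> /cvg_normcP/(_ _ d0)[K _ HK].
  have := HK (maxn K k0) (leq_maxl _ _) => /= H1.
  have H2 := Snear n (maxn K k0) nn (leq_maxr _ _).
  rewrite -(subrK (S n (maxn K k0)) (\sum_(i < n) r i)) -addrA.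
  by rewrite (le_trans (normcD _ _))// lerD// ltW.
have lim_cols k : (k0 <= k)%N -> normc (\sum_(j < k) c j - S n0 k0) <= d + d.
  move=> kk.
  have : (fun n => S n k) @ \oo --> \sum_(j < k) c j.
    have -> : S ^~ k = fun n => \sum_(j < k) \sum_(i < n) u i j.
      by apply/funext => n; exact: exchange_big.
    apply: cvg_finsum => j _; apply: cvg_trans (uc j).
    by apply: near_eq_cvg; near=> n; rewrite /series/= big_mkord.
  move=> /cvg_normcP/(_ _ d0)[K _ HK].
  have := HK (maxn K n0) (leq_maxl _ _) => /= H1.
  have H2 := Snear (maxn K n0) k (leq_maxr _ _) kk.
  rewrite -(subrK (S (maxn K n0) k) (\sum_(j < k) c j)) -addrA.
  by rewrite (le_trans (normcD _ _))// lerD// ltW.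
have [N HN] := cvg_series_normc rL d0.
exists k0 => // k /= kk; rewrite /series/= big_mkord.
have H1 := HN _ (leq_maxl N n0).
have H2 := lim_rows _ (leq_maxr N n0).
have H3 := lim_cols _ kk.
set rs := \sum_(i < maxn N n0) r i in H1 H2; set cs := \sum_(j < k) c j in H3 *.
have -> : L - cs = (L - rs) + ((rs - S n0 k0) + (S n0 k0 - cs)).
  by rewrite !addrA !subrK.
have := normcD (L - rs) (rs - S n0 k0 + (S n0 k0 - cs)).
have := normcD (rs - S n0 k0) (S n0 k0 - cs); rewrite (normcB (S n0 k0) cs).
by move: H1 H2 H3; rewrite /d; lra.
Unshelve. all: by end_near. Qed.

End complex_convergence.

(** * The complex exponential as the sum of its power series *)

Section complex_exponential.
Variable R : realType.
Implicit Types (x y : R) (z w : R[i]).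

Lemma mulc_real z x : z * x%:C = (complex.Re z * x) +i* (complex.Im z * x).
Proof. by case: z => a b; simpc. Qed.

Lemma invc_nat n : (n%:R : R[i])^-1 = (n%:R^-1)%:C.
Proof. by rewrite fmorphV rmorph_nat. Qed.

(** The two components have the shape of [cos_coeff] and [sin_coeff] before division by the
    factorial. *)
Lemma exprci y n : (0 +i* y) ^+ n =
  ((~~ odd n)%:R * (-1) ^+ n./2 * y ^+ n)
    +i* ((odd n)%:R * (-1) ^+ n.-1./2 * y ^+ n).
Proof.
have even m : (0 +i* y) ^+ m.*2 = ((-1) ^+ m * y ^+ m.*2)%:C.
  rewrite -mul2n !exprM -exprMn rmorphXn; congr (_ ^+ _).
  by rewrite !expr2; simpc.
rewrite -[n in LHS]odd_double_half -[n in y ^+ n]odd_double_half.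
have [no|ne] := boolP (odd n); last first.
  by rewrite add0n even mul1r !mul0r.
have -> : n.-1./2 = n./2 by rewrite -[n]odd_double_half no /= doubleK
  uphalf_double.
rewrite add1n exprS even [in X in _ +i* (_ * X)]exprS.
by simpc; congr (_ +i* _); ring.
Qed.

Lemma series_exp_real x :
  series (fun k => x%:C ^+ k / k`!%:R) @ \oo --> (expR x)%:C.
Proof.
have /cvg_real_complex := is_cvg_series_exp_coeff x.
apply: cvg_trans; apply: near_eq_cvg; apply: nearW => n.
rewrite /series/= rmorph_sum; apply: eq_bigr => k _.
by rewrite /exp_coeff/= invc_nat -rmorphXn -rmorphM.
Qed.

Lemma series_exp_imaginary y :
  series (fun k => (0 +i* y) ^+ k / k`!%:R) @ \oo --> cos y +i* sin y.
Proof.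
have E k : (0 +i* y) ^+ k / k`!%:R = cos_coeff y k +i* sin_coeff y k.
  by rewrite exprci invc_nat mulc_real.
apply: cvg_complex => /=.
  rewrite unlock.
  have := @is_cvg_series_cos_coeff R y.
  apply: cvg_trans; apply: near_eq_cvg; apply: nearW => n.
  by rewrite /series/= Re_sum; apply: eq_bigr => k _; rewrite E.
rewrite unlock.
have := @is_cvg_series_sin_coeff R y.
apply: cvg_trans; apply: near_eq_cvg; apply: nearW => n.
by rewrite /series/= Im_sum; apply: eq_bigr => k _; rewrite E.
Qed.

Lemma normc_exp_term z k : normc (z ^+ k / k`!%:R) = normc z ^+ k / k`!%:R.
Proof.
by rewrite Normc.normcM normcX invc_nat normc_real ger0_norm// invr_ge0.
Qed.

Lemma normc_exp_sum_le z n :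
  \sum_(k < n) normc (z ^+ k / k`!%:R) <= expR (normc z).
Proof.
rewrite -(big_mkord xpredT (fun k => normc (z ^+ k / k`!%:R))).
under eq_bigr do rewrite normc_exp_term.
apply: nondecreasing_cvgn_le; last exact: is_cvg_series_exp_coeff.
by apply: nondecreasing_series => k _ _; rewrite divr_ge0 ?exprn_ge0 ?normc_ge0.
Qed.

(** Row k of a Cauchy product indexed by total degree begins with k zeros. Truncated subtraction
    covers n <= k, where only zeros are added. *)
Lemma sum_shifted (V : zmodType) (v : nat -> V) k n :
  \sum_(m < n) (if (k <= m)%N then v (m - k)%N else 0) =
  \sum_(m < (n - k)%N) v m.
Proof.
elim: n => [|n IH]; first by rewrite !big_ord0.
rewrite big_ord_recr/= IH; case: leqP => kn; last first.
  by rewrite addr0; have /eqP-> : (n.+1 - k == 0)%N; rewrite ?subn_eq0//;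
    have /eqP-> : (n - k == 0)%N by rewrite subn_eq0 ltnW.
by rewrite subSn// big_ord_recr.
Qed.

(* The Cauchy product of the series of [expR (Re z)] and
   [cos (Im z) + i sin (Im z)] is that of [z] by the binomial theorem. *)
Lemma series_cexp z : series (fun k => z ^+ k / k`!%:R) @ \oo --> cexp z.
Proof.
pose a := (complex.Re z)%:C; pose b := 0 +i* complex.Im z.
have zE : z = b + a by rewrite /a /b; case: (z) => x y; simpc.
pose e (w : R[i]) k := w ^+ k / k`!%:R.
(* Here k is the exponent of [a] and m the total degree: row k sums to [e a k] times the exponential
   of [b], column m to [e z m]. *)
pose u k m := e a k * (if (k <= m)%N then e b (m - k)%N else 0).
apply: (@series_exchange _ u (fun k => e a k * (cos (complex.Im z) +i* sin
  (complex.Im z)))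
  _ (expR (normc a) * expR (normc b))).
- move=> n k; apply: le_trans (_ : \sum_(i < n) normc (e a i) * expR (normc b)
  <= _).
    apply: ler_sum => i _; rewrite /u.
    under eq_bigr do rewrite Normc.normcM.
    rewrite -mulr_sumr ler_wpM2l ?normc_ge0//.
    have -> : \sum_(m < k) normc (if (i <= m)%N then e b (m - i)%N else 0) =
        \sum_(m < k) (if (i <= m)%N then normc (e b (m - i)%N) else 0).
      by apply: eq_bigr => m _; case: ifP => // _; rewrite Normc.normc0.
    by rewrite (sum_shifted (fun m => normc (e b m))) normc_exp_sum_le.
  by rewrite -mulr_suml ler_wpM2r ?expR_ge0// normc_exp_sum_le.
- move=> k; have -> : series (u k) = fun n => e a k * series (e b) (n - k)%N.
    apply/funext => n; rewrite /series/= !big_mkord /u -mulr_sumr.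
    by rewrite (sum_shifted (e b)).
  apply: cvgM; first exact: cvg_cst.
  apply: cvg_comp (@series_exp_imaginary (complex.Im z)).
  exact: cvg_subnr.
(* Column m vanishes beyond row m, so its partial sums are eventually the finite binomial sum. *)
- move=> m; apply: cvg_near_cst; near=> n.
  have mn : (m < n)%N by near: n; exact: nbhs_infty_gt.
  rewrite /series/= (big_cat_nat (leq0n m.+1) mn)/= [X in _ + X]big_nat_cond [X
    in _ + X]big1 ?addr0; last first.
    move=> i /andP[/andP[mi _] _]; rewrite /u leqNgt mi/= mulr0//.
  rewrite big_mkord.
  transitivity (\sum_(i < m.+1) ((b ^+ (m - i) * a ^+ i) *+ 'C(m, i)) / m`!%:R).
    apply: eq_bigr => i _; have im : (i <= m)%N by rewrite -ltnS.
    rewrite /u im /e -[_ *+ 'C(m, i)]mulr_natr -(bin_fact im) !natrM.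
    have : (i`!%:R : R[i]) != 0 by rewrite pnatr_eq0 -lt0n fact_gt0.
    have : ((m - i)`!%:R : R[i]) != 0 by rewrite pnatr_eq0 -lt0n fact_gt0.
    have : ('C(m, i)%:R : R[i]) != 0 by rewrite pnatr_eq0 -lt0n bin_gt0.
    by move=> *; field; repeat (apply/andP; split).
  by rewrite -mulr_suml -exprDn -zE.
- rewrite (_ : series _ = fun n => series (e a) n * (cos (complex.Im z) +i* sin
  (complex.Im z))).
    by apply: cvgM; [exact: series_exp_real | exact: cvg_cst].
  by apply/funext => n; rewrite /series/= mulr_suml.
Unshelve. all: by end_near. Qed.

End complex_exponential.

(** * Growth of the partial sums in ces_p *)

Section dyadic_blocks.
Variable R : realType.
Implicit Types (v : nat -> R) (K r : R).

(** Because of the shift, block j consists of the n with 2^j <= n + 1 < 2^(j+1), and the blocks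
    before J fill the indices below 2^J - 1. As N <= 2^N - 1, the first N blocks cover the sum, and
    their bounds form a geometric sum. *)
Lemma dyadic_sum_le v K r : (forall n, 0 <= v n) -> 0 <= r < 1 ->
  (forall j, \sum_((2 ^ j).-1 <= n < (2 ^ j.+1).-1) v n <= K * r ^+ j) ->
  forall N, \sum_(n < N) v n <= K / (1 - r).
Proof.
move=> v0 /andP[r0 r1] vK N.
have r10 : 0 < 1 - r by rewrite subr_gt0.
have K0 : 0 <= K.
  by have := vK 0%N; rewrite expr0 mulr1; apply: le_trans; exact: sumr_ge0.
have step J : \sum_(0 <= n < (2 ^ J).-1) v n <= K * (1 - r ^+ J) / (1 - r).
  elim: J => [|J IH]; first by rewrite big_geq// expr0 subrr mulr0 mul0r.
  rewrite (@big_cat_nat _ _ _ (2 ^ J).-1)//=; last first.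
    by rewrite -!subn1 leq_sub2r// leq_exp2l.
  apply: le_trans (lerD IH (vK J)) _.
  rewrite le_eqVlt; apply/orP; left; apply/eqP; rewrite exprS.
  by field; rewrite gt_eqF.
have NN : (N <= (2 ^ N).-1)%N by rewrite -ltnS prednK ?expn_gt0// ltn_expl.
rewrite -(big_mkord xpredT v); apply: le_trans (_ : \sum_(0 <= n < (2 ^ N).-1) v
  n <= _).
  by rewrite (big_cat_nat (leq0n N) NN)/= lerDl sumr_ge0.
apply: le_trans (step N) _; rewrite ler_pdivrMr// mulfVK ?gt_eqF//.
by rewrite ler_piMr// gerBl exprn_ge0.
Qed.

End dyadic_blocks.

Section cesaro.
Variable R : realType.
Implicit Types (p q M : R) (a : nat -> R[i]).

Definition ces_mean a n : R := n.+1%:R^-1 * \sum_(k < n.+1) normc (a k).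

Lemma ces_mean_ge0 a n : 0 <= ces_mean a n.
Proof. by rewrite mulr_ge0 ?invr_ge0// sumr_ge0// => i _; exact: normc_ge0. Qed.

(** Powers with positive exponent are monotone on nonnegative extended reals, and a series of
    nonnegative terms is bounded exactly as its partial sums are. This replaces the extended norm by
    finite real sums. *)
Lemma ces_norm_leP p a M : 0 < p -> 0 <= M ->
  (ces_norm p a <= M%:E)%E <->
  forall N, \sum_(n < N) ces_mean a n `^ p <= M `^ p.
Proof.
move=> p0 M0.
pose S := (\sum_(0 <= n <oo) (ces_mean a n `^ p)%:E)%E.
have S0 : (0 <= S)%E by apply: nneseries_ge0 => n _ _; rewrite lee_fin powR_ge0.
have -> : ces_norm p a = (S `^ p^-1)%E by [].
have -> : (S `^ p^-1 <= M%:E)%E <-> (S <= (M `^ p)%:E)%E.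
  have Sp : S = ((S `^ p^-1) `^ p)%E.
    by rewrite -poweRrM mulVf ?gt_eqF// poweRe1.
  have Mp : M = (M `^ p) `^ p^-1.
    by rewrite -powRrM mulfV ?gt_eqF// powRr1.
  split=> H.
    rewrite Sp -poweR_EFin; apply: gt0_ler_poweR H;
      rewrite ?in_itv/= ?poweR_ge0 ?lee_fin ?leey ?M0 ?(ltW p0)//.
  rewrite Mp -poweR_EFin; apply: gt0_ler_poweR H;
    rewrite ?in_itv/= ?invr_ge0 ?lee_fin ?powR_ge0 ?leey ?S0 ?(ltW p0)//.
split=> [SM N|SM].
  rewrite -lee_fin (le_trans _ SM)// -sumEFin -(big_mkord xpredT (fun n =>
    (ces_mean a n `^ p)%:E)).
  by apply: nneseries_lim_ge => n _ _; rewrite lee_fin powR_ge0.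
apply: lime_le.
  by apply: is_cvg_nneseries => n _ _; rewrite lee_fin powR_ge0.
by apply: nearW => N; rewrite sumEFin lee_fin big_mkord.
Qed.

Lemma ces_norm_ge0 p a : (0 <= ces_norm p a)%E.
Proof. exact: poweR_ge0. Qed.

Lemma ces_normE p a : ces p a -> ces_norm p a = (fine (ces_norm p a))%:E.
Proof. by move=> ap; rewrite fineK// ge0_fin_numE// ces_norm_ge0. Qed.

Lemma ces_le p a M : 0 < p -> 0 <= M ->
  (forall N, \sum_(n < N) ces_mean a n `^ p <= M `^ p) -> ces p a.
Proof.
by move=> p0 M0 /(ces_norm_leP _ p0 M0) aM; rewrite /ces/= (le_lt_trans aM)//
  ltry.
Qed.

(** With [A] the sum on the left and [M] the norm, the N means of index N to 2N - 1 are at least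
    [m], that is A / (2N). Hence N m^p <= M^p, and the p-th root gives the claim with K = 2M. *)
Lemma ces_growth p a : 0 < p -> ces p a -> exists2 K, 0 <= K &
  forall N, (0 < N)%N -> \sum_(k < N) normc (a k) <= K * N%:R `^ (1 - p^-1).
Proof.
move=> p0 ap; pose M := fine (ces_norm p a).
have M0 : 0 <= M by rewrite fine_ge0// ces_norm_ge0.
have /ces_norm_leP aM : (ces_norm p a <= M%:E)%E by rewrite /M -ces_normE.
exists (2 * M) => [|N N0]; first by rewrite mulr_ge0.
have N0R : (0 : R) < N%:R by rewrite ltr0n.
set A := \sum_(k < N) _; have A0 : 0 <= A by rewrite sumr_ge0// => i _;
  exact: normc_ge0.
pose m := A / (2 * N%:R).
have m0 : 0 <= m by rewrite divr_ge0.
have : N%:R * m `^ p <= M `^ p.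
  apply: le_trans (aM p0 M0 (N + N)%N).
  rewrite -(big_mkord xpredT (fun n => ces_mean a n `^ p)) (@big_cat_nat _ _ _
    N)//= ?leq_addl//.
  apply: ler_wpDl; first by rewrite sumr_ge0// => n _; exact: powR_ge0.
  rewrite -[N%:R](_ : \sum_(N <= n < N + N) 1 = _); last first.
    by rewrite big_const_nat addnK iter_addr_0.
  rewrite mulr_suml; apply: ler_sum_nat => n /andP[Nn nN].
  rewrite mul1r.
  apply: ge0_ler_powR; rewrite ?nnegrE ?ces_mean_ge0 ?(ltW p0)//.
  rewrite /m /ces_mean [A / _]mulrC ler_pM ?invr_ge0 ?mulr_ge0//.
  - by rewrite lef_pV2 ?posrE ?mulr_gt0 ?ltr0n// -natrM ler_nat mul2n -addnn.
  - rewrite /A -!(big_mkord xpredT (fun k => normc (a k))).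
    by rewrite (big_cat_nat (leq0n N) (leqW Nn))/= lerDl sumr_ge0// => i _;
      exact: normc_ge0.
have -> : N%:R * m `^ p = (N%:R `^ p^-1 * m) `^ p.
  by rewrite powRM ?powR_ge0// -powRrM mulVf ?gt_eqF// powRr1// ltW.
have H0 : 0 <= N%:R `^ p^-1 * m by rewrite mulr_ge0// powR_ge0.
move=> H.
have : N%:R `^ p^-1 * m <= M.
  have := ge0_ler_powR (ltW (_ : 0 < p^-1)); rewrite invr_gt0 => /(_ p0).
  move=> /(_ _ _ _ _ H); rewrite !nnegrE !powR_ge0 => /(_ isT isT).
  by rewrite -!powRrM mulfV ?gt_eqF// !powRr1.
rewrite /m mulrA ler_pdivrMr ?mulr_gt0// powRB;
  last by rewrite pnatr_eq0 -lt0n N0 implybT.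
rewrite powRr1 ?(ltW N0R)//.
move=> NM; rewrite mulrA ler_pdivlMr ?powR_gt0//.
by rewrite mulrC (le_trans NM)// mulrCA mulrA.
Qed.

End cesaro.

(** * Half-planes of convergence *)

Section dirichlet_convergence.
Variable R : realType.
Implicit Types (p x : R) (a : nat -> R[i]) (s z : R[i]).

Lemma normc_cexp z : normc (cexp z) = expR (complex.Re z).
Proof.
rewrite Normc.normcM normc_real ger0_norm ?expR_ge0//=.
by rewrite cos2Dsin2 sqrtr1 mulr1.
Qed.

Lemma normc_dirichlet_term a s n :
  normc (dirichlet_term a s n) = normc (a n) * n.+1%:R `^ (- complex.Re s).
Proof.
rewrite Normc.normcM normc_cexp mulc_real/= /powR pnatr_eq0.
by case: s => b c.
Qed.

Lemma powRX (b x : R) j : 0 <= b -> (b ^+ j) `^ x = (b `^ x) ^+ j.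
Proof.
move=> b0; elim: j => [|j IH]; first by rewrite !expr0 powR1.
by rewrite !exprS powRM ?exprn_ge0// IH.
Qed.

Lemma powR2X j x : (2 ^ j)%:R `^ x = (2 `^ x) ^+ j :> R.
Proof. by rewrite natrX powRX. Qed.

Lemma powR2_lt1 x : (2 `^ x < 1 :> R) = (x < 0).
Proof.
rewrite /powR pnatr_eq0/= -[X in _ < X]expR0 ltr_expR pmulr_llt0//.
by rewrite ln_gt0// ltr1n.
Qed.

Lemma powR2_gt1 x : (1 < 2 `^ x :> R) = (0 < x).
Proof.
rewrite /powR pnatr_eq0/= -[X in X < _]expR0 ltr_expR pmulr_lgt0//.
by rewrite ln_gt0// ltr1n.
Qed.

(** On block j the weight is at most 2^(-jx), and [ces_growth] at N = 2^(j+1) bounds the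
    coefficients by K 2^((j+1)y) with y = 1 - 1/p. The blocks thus decay with ratio 2^(y-x), which
    is below 1. *)
Lemma ces_dirichlet_bound p a x : 1 < p -> ces p a -> 1 - p^-1 < x ->
  exists M, forall N, \sum_(n < N) normc (a n) * n.+1%:R `^ (- x) <= M.
Proof.
move=> p1 ap px; have p0 : 0 < p by rewrite (lt_trans _ p1).
have [K K0 aK] := ces_growth p0 ap.
have y0 : 0 <= 1 - p^-1 by rewrite subr_ge0 invf_le1// ltW.
have x0 : 0 <= x by rewrite (le_trans y0)// ltW.
set y := 1 - p^-1 in px aK y0.
exists (K * 2 `^ y / (1 - 2 `^ (y - x))).
apply: (@dyadic_sum_le _ (fun n => normc (a n) * n.+1%:R `^ (- x))).
- by move=> n; rewrite mulr_ge0 ?normc_ge0 ?powR_ge0.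
- by rewrite powR_ge0/= powR2_lt1 subr_lt0.
move=> j; apply: le_trans (_ : \sum_((2 ^ j).-1 <= n < (2 ^ j.+1).-1) normc (a
  n) * (2 ^ j)%:R `^ (- x) <= _).
  apply: ler_sum_nat => n /andP[jn nj].
  rewrite ler_wpM2l ?normc_ge0// !powRN lef_pV2 ?posrE ?powR_gt0 ?ltr0n
    ?expn_gt0//.
  by apply: ge0_ler_powR => //; rewrite ?nnegrE// ler_nat -(prednK (_ : 0 < 2 ^
    j)%N) ?expn_gt0.
rewrite -mulr_suml.
have jj : ((2 ^ j).-1 <= (2 ^ j.+1).-1)%N by rewrite -!subn1 leq_sub2r//
  leq_exp2l.
have jj1 : ((2 ^ j.+1).-1 <= 2 ^ j.+1)%N by rewrite leq_pred.
apply: le_trans (_ : (K * (2 ^ j.+1)%:R `^ y) * (2 ^ j)%:R `^ (- x) <= _).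
  rewrite ler_wpM2r ?powR_ge0//; apply: le_trans (aK _ _);
    last by rewrite expn_gt0.
  rewrite -(big_mkord xpredT (fun k => normc (a k))).
  rewrite (big_cat_nat (leq0n _) jj1)/= (big_cat_nat (leq0n _) jj)/=.
  rewrite -addrA addrCA lerDl addr_ge0// sumr_ge0// => i _; exact: normc_ge0.
rewrite !powR2X exprS [2 `^ (y - x)]powRD; last by rewrite pnatr_eq0 implybT.
by rewrite exprMn !mulrA.
Qed.

Lemma ces_dirichlet_cvg p a s : 1 < p -> ces p a -> 1 - p^-1 < complex.Re s ->
  dirichlet_cvg a s /\ dirichlet_abs_cvg a s.
Proof.
move=> p1 ap /(ces_dirichlet_bound p1 ap)[M aM].
have {}aM n : \sum_(k < n) normc (dirichlet_term a s k) <= M.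
  by under eq_bigr do rewrite normc_dirichlet_term; exact: aM.
by split; [exact: normc_series_cvg aM | exact: normc_series_abs_cvg aM].
Qed.

End dirichlet_convergence.

(** * Sharpness of the half-plane: a lacunary series *)

Section lacunary_example.
Variables (R : realType) (theta : R).
Implicit Types p : R.

(* The coefficient of 2^j is 2^(j theta), and [lacunary_coef n] is that of
   n + 1. *)
Definition lacunary_coef (n : nat) : R[i] :=
  if n.+1 == (2 ^ trunc_log 2 n.+1)%N then (n.+1%:R `^ theta)%:C else 0.

Lemma lacunary_pow j : lacunary_coef (2 ^ j).-1 = ((2 `^ theta) ^+ j)%:C.
Proof.
by rewrite /lacunary_coef prednK ?expn_gt0// trunc_expnK// eqxx powR2X.
Qed.

(** In this range n + 1 lies strictly between two consecutive powers of 2. *)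
Lemma lacunary_block j n : ((2 ^ j) <= n < (2 ^ j.+1).-1)%N ->
  lacunary_coef n = 0.
Proof.
move=> /andP[jn nj]; rewrite /lacunary_coef (@trunc_log_eq 2 j)//.
  by rewrite gtn_eqF// ltnS.
by rewrite (leq_trans jn)//= -ltn_predRL.
Qed.

(** The nonzero coefficients involved are rho^j for j < J, with sum (rho^J - 1) / (rho - 1). Without
    the -1 the bound passes from J to J + 1 by an identity. *)
Lemma lacunary_sum J : 0 < theta ->
  \sum_(k < (2 ^ J).-1) normc (lacunary_coef k)
    <= (2 `^ theta) ^+ J / (2 `^ theta - 1).
Proof.
move=> theta0; set rho := 2 `^ theta.
have rho1 : 0 < rho - 1 by rewrite subr_gt0 powR2_gt1.
have rho0 : 0 <= rho := powR_ge0 _ _.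
rewrite -(big_mkord xpredT (fun k => normc (lacunary_coef k))).
elim: J => [|J IH]; first by rewrite big_geq// divr_ge0 ?exprn_ge0// ltW.
rewrite (@big_cat_nat _ _ _ (2 ^ J).-1)//=; last first.
  by rewrite -!subn1 leq_sub2r// leq_exp2l.
have lt2 : ((2 ^ J).-1 < (2 ^ J.+1).-1)%N.
  by rewrite ltn_predRL prednK ?expn_gt0// ltn_exp2l.
rewrite (big_ltn lt2) lacunary_pow normc_real ger0_norm ?exprn_ge0//.
rewrite prednK ?expn_gt0// [X in _ + (_ + X)]big_nat_cond.
rewrite [X in _ + (_ + X)]big1 => [|k /andP[kJ _]]; last first.
  by rewrite (lacunary_block kJ) Normc.normc0.
rewrite addr0; apply: le_trans (lerD IH (lexx _)) _.
rewrite le_eqVlt; apply/orP; left; apply/eqP; rewrite exprS.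
by field; rewrite gt_eqF.
Qed.

(** By [lacunary_sum] the means on block j are at most 2^(-j) rho^(j+1) / (rho - 1) = K (rho/2)^j.
    The block has 2^j indices, so it contributes at most K^p r^j with r = 2 (rho/2)^p, and r < 1 is
    the condition theta < 1 - 1/p. *)
Lemma lacunary_ces p : 1 < p -> 0 < theta -> theta < 1 - p^-1 ->
  ces p lacunary_coef.
Proof.
move=> p1 theta0 thetap; have p0 : 0 < p by rewrite (lt_trans _ p1).
set rho := 2 `^ theta : R.
have rho1 : 0 < rho - 1 by rewrite subr_gt0 powR2_gt1.
pose K := rho / (rho - 1); have K0 : 0 <= K by rewrite divr_ge0 ?powR_ge0// ltW.
pose r := 2 `^ (1 + (theta - 1) * p) : R.
have r1 : r < 1.
  rewrite powR2_lt1 -ltrBrDl sub0r -ltr_pdivlMr// mulNr mul1r.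
  by move: thetap; lra.
pose M := K `^ p / (1 - r).
have M0 : 0 <= M by rewrite divr_ge0 ?powR_ge0// subr_ge0 ltW.
apply: (@ces_le _ p _ (M `^ p^-1)) => //; first exact: powR_ge0.
rewrite -powRrM mulVf ?gt_eqF// powRr1//.
apply: (@dyadic_sum_le _ (fun n => ces_mean lacunary_coef n `^ p)) => [n||j];
  first exact: powR_ge0.
  by rewrite powR_ge0.
apply: le_trans (_ : \sum_((2 ^ j).-1 <= n < (2 ^ j.+1).-1) (K * (rho / 2) ^+ j)
  `^ p <= _).
  apply: ler_sum_nat => n /andP[jn nj].
  apply: ge0_ler_powR; rewrite ?nnegrE ?ces_mean_ge0 ?(ltW p0)//.
    by rewrite mulr_ge0// exprn_ge0// divr_ge0 ?powR_ge0.
  rewrite /ces_mean expr_div_n mulrA [leRHS]mulrC ler_pM ?invr_ge0//.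
  - by rewrite sumr_ge0// => i _; exact: normc_ge0.
  - rewrite -natrX lef_pV2 ?posrE ?ltr0n ?expn_gt0// ler_nat.
    by rewrite -(prednK (_ : 0 < 2 ^ j)%N) ?expn_gt0.
  - apply: le_trans (_ : \sum_(k < (2 ^ j.+1).-1) normc (lacunary_coef k) <= _).
      rewrite -!(big_mkord xpredT (fun k => normc (lacunary_coef k))).
      by rewrite (big_cat_nat (leq0n _) nj)/= lerDl sumr_ge0// => i _;
        exact: normc_ge0.
    by apply: le_trans (lacunary_sum _ theta0) _; rewrite exprS mulrAC.
rewrite big_const_nat iter_addr_0.
have -> : ((2 ^ j.+1).-1 - (2 ^ j).-1 = 2 ^ j)%N.
  by rewrite -!subn1 subnBA ?expn_gt0// subnK ?expn_gt0// expnS mul2n -addnn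
    addnK.
have rho20 : 0 <= (rho / 2) ^+ j by rewrite exprn_ge0// divr_ge0 ?powR_ge0.
rewrite (powRM _ K0 rho20) -[_ *+ _]mulr_natr -mulrA ler_wpM2l ?powR_ge0//.
have rho2 : 0 <= rho / 2 by rewrite divr_ge0 ?powR_ge0.
have rE : r = 2 * (rho / 2) `^ p.
  rewrite /r powRD ?pnatr_eq0 ?implybT// powRr1// powRrM powRB ?pnatr_eq0
    ?implybT//.
  by rewrite powRr1.
by rewrite rE powRX// natrX exprMn mulrC.
Qed.

Lemma lacunary_term_pow j :
  normc (dirichlet_term lacunary_coef theta%:C (2 ^ j).-1) = 1.
Proof.
rewrite normc_dirichlet_term lacunary_pow normc_real ger0_norm ?exprn_ge0
  ?powR_ge0//.
rewrite prednK ?expn_gt0// powR2X/= -exprMn powRN mulfV ?expr1n//.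
Qed.

Lemma lacunary_term_ncvg0 :
  ~ (dirichlet_term lacunary_coef theta%:C @ \oo --> 0).
Proof.
move=> /cvg_normcP/(_ _ ltr01)[N _ HN].
(* The index 2^N - 1 is at least N and carries a term of modulus 1. *)
have := HN (2 ^ N).-1; rewrite /= sub0r normcN lacunary_term_pow ltxx.
by case/(_ _)/negP => //; rewrite -ltnS prednK ?expn_gt0// ltn_expl.
Qed.

Lemma lacunary_dvg : ~ dirichlet_cvg lacunary_coef theta%:C.
Proof. by move=> /cvg_series_cvg_0; exact: lacunary_term_ncvg0. Qed.

Lemma lacunary_abs_dvg : ~ dirichlet_abs_cvg lacunary_coef theta%:C.
Proof.
move=> /cvg_series_cvg_0 /= H; apply: lacunary_term_ncvg0.
by apply/norm_cvg0P.
Qed.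

End lacunary_example.

(** * The Banach space ces_p *)

Section ces_norm_theory.
Variable R : realType.
Implicit Types (p : R) (a b : nat -> R[i]).

(** Seen as an L^p norm of the means for the counting measure, the norm falls under Minkowski's
    inequality. *)
Lemma ces_norm_Lnorm p a : 0 < p ->
  ces_norm p a = Lnorm counting p%:E (EFin \o ces_mean a).
Proof.
move=> p0; rewrite Lnorm_counting//; congr (poweR _ _).
by apply: eq_eseriesr => n _ /=; rewrite ger0_norm// ces_mean_ge0.
Qed.

Lemma ces_meanD a b n : ces_mean (a + b) n <= ces_mean a n + ces_mean b n.
Proof.
rewrite /ces_mean -mulrDr ler_wpM2l ?invr_ge0// -big_split ler_sum// => k _.
exact: normcD.
Qed.

Lemma ces_meanZ (c : R[i]) a n : ces_mean (c *: a) n = normc c * ces_mean a n.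
Proof.
rewrite /ces_mean [RHS]mulrCA; congr (_ * _); rewrite mulr_sumr;
  apply: eq_bigr => k _.
exact: Normc.normcM.
Qed.

Lemma ces_norm_le p a (f : nat -> R) : 0 < p ->
  (forall n, ces_mean a n <= f n) ->
  (ces_norm p a <= Lnorm counting p%:E (EFin \o f))%E.
Proof.
move=> p0 af; rewrite Lnorm_counting//.
apply: gt0_ler_poweR; first by rewrite invr_ge0 ltW.
- by rewrite in_itv/= leey andbT nneseries_ge0// => n _ _;
  rewrite lee_fin powR_ge0.
- by rewrite in_itv/= leey andbT nneseries_ge0// => n _ _; exact: poweR_ge0.
apply: lee_nneseries => [n _ _|n _]; first by rewrite lee_fin powR_ge0.
rewrite [leRHS](_ : _ = (`|f n| `^ p)%:E)// lee_fin.
apply: ge0_ler_powR; rewrite ?nnegrE ?ces_mean_ge0 ?(ltW p0)//.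
by rewrite (le_trans (af n))// ler_norm.
Qed.

Lemma ces_normD p a b : 1 < p ->
  (ces_norm p (a + b)%R <= ces_norm p a + ces_norm p b)%E.
Proof.
move=> p1; have p0 : 0 < p by rewrite (lt_trans _ p1).
apply: le_trans (ces_norm_le p0 (ces_meanD a b)) _.
rewrite !ces_norm_Lnorm//; apply: minkowski_EFin; last exact: ltW.
- by [].
- by [].
Qed.

Lemma ces_normZ p (c : R[i]) a : 0 < p ->
  ces_norm p (c *: a) = ((normc c)%:E * ces_norm p a)%E.
Proof.
move=> p0; rewrite /ces_norm.
rewrite (_ : (\sum_(0 <= n <oo) _)%E = ((normc c `^ p)%:E *
    \sum_(0 <= n <oo) (ces_mean a n `^ p)%:E)%E); last first.
  rewrite -nneseriesZl//; last by move=> n _; rewrite lee_fin powR_ge0.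
  apply: eq_eseriesr => n _; rewrite -EFinM -powRM ?normc_ge0 ?ces_mean_ge0//.
  by rewrite -ces_meanZ.
rewrite poweRM ?lee_fin ?powR_ge0//; last first.
  by rewrite nneseries_ge0// => n _ _; rewrite lee_fin powR_ge0.
by rewrite poweR_EFin -powRrM mulfV ?gt_eqF// powRr1// normc_ge0.
Qed.

Lemma ces_norm0 p : 0 < p -> ces_norm p (0 : nat -> R[i]) = 0%E.
Proof.
by move=> p0; rewrite -(scale0r (0 : nat -> R[i])) ces_normZ// Normc.normc0
  mul0e.
Qed.

(** The modulus of [a n] divided by n + 1 is part of the n-th mean, whose p-th power is one term of
    the series. Coefficients are therefore continuous for the norm, which separates points. *)
Lemma ces_coef_le p a M n : 0 < p -> 0 <= M -> (ces_norm p a <= M%:E)%E ->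
  normc (a n) <= n.+1%:R * M.
Proof.
move=> p0 M0 /(ces_norm_leP _ p0 M0) aM.
rewrite mulrC -ler_pdivrMr// mulrC.
apply: (le_trans (_ : _ <= ces_mean a n)).
  rewrite ler_wpM2l ?invr_ge0// big_ord_recr/= lerDr sumr_ge0// => i _.
  exact: normc_ge0.
have : ces_mean a n `^ p <= M `^ p.
  apply: le_trans (aM n.+1); rewrite big_ord_recr/= lerDr sumr_ge0// => i _.
  exact: powR_ge0.
by rewrite leNgt [in X in _ -> X]leNgt; apply: contraNN => /gt0_ltr_powR -> //;
  rewrite nnegrE ?ces_mean_ge0.
Qed.

(** The proof [p1] is an argument so that the submodule instance, which rests on Minkowski's
    inequality, can be attached to the predicate. *)
Definition ces_pred p (p1 : 1 < p) : {pred nat -> R[i]} :=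
  fun a => `[< ces p a >].

Lemma ces_predP p (p1 : 1 < p) a : a \in ces_pred p1 <-> ces p a.
Proof. by split=> /asboolP. Qed.

Lemma ces_submod_closed p (p1 : 1 < p) : submod_closed (ces_pred p1).
Proof.
have p0 : 0 < p by rewrite (lt_trans _ p1).
split; first by apply/ces_predP; rewrite /ces/= ces_norm0 ?ltry.
move=> c a b /ces_predP ap /ces_predP bp; apply/ces_predP; rewrite /ces/=.
apply: le_lt_trans (ces_normD (c *: a) b p1) _; rewrite lte_add_pinfty//.
by rewrite ces_normZ// lte_mul_pinfty ?lee_fin ?normc_ge0.
Qed.

HB.instance Definition _ p (p1 : 1 < p) :=
  GRing.isSubmodClosed.Build _ _ (ces_pred p1) (ces_submod_closed p1).

End ces_norm_theory.

Record ces_space (R : realType) (p : R) (p1 : 1 < p) :=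
  CesSpace { ces_val :> nat -> R[i]; _ : ces_val \in ces_pred p1 }.

Section ces_banach.
Variables (R : realType) (p : R) (p1 : 1 < p).
Local Notation V := (ces_space p1).

HB.instance Definition _ := [isSub for @ces_val R p p1].
HB.instance Definition _ := [Choice of V by <:].
HB.instance Definition _ := [SubChoice_isSubLmodule of V by <:].

Let p0 : 0 < p. Proof. exact: lt_trans ltr01 p1. Qed.

Definition ces_fine (x : V) : R := fine (ces_norm p x).

Lemma ces_valP (x : V) : ces p x.
Proof. by apply/(ces_predP p1); exact: (valP x). Qed.

Lemma ces_fineE (x : V) : ces_norm p x = (ces_fine x)%:E.
Proof. by rewrite /ces_fine -ces_normE//; exact: ces_valP. Qed.

Lemma ces_fine_ge0 (x : V) : 0 <= ces_fine x.
Proof. by rewrite fine_ge0// ces_norm_ge0. Qed.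

Lemma ces_fineD (x y : V) : ces_fine (x + y) <= ces_fine x + ces_fine y.
Proof. by rewrite -lee_fin EFinD -!ces_fineE; exact: ces_normD. Qed.

Lemma ces_fineZ (c : R[i]) (x : V) : ces_fine (c *: x) = normc c * ces_fine x.
Proof. by apply: EFin_inj; rewrite EFinM -!ces_fineE; exact: ces_normZ. Qed.

Lemma ces_space_coef (x : V) n : normc (x n) <= n.+1%:R * ces_fine x.
Proof. by apply: (ces_coef_le _ p0); rewrite ?ces_fine_ge0// ces_fineE. Qed.

(** A normed module over [R[i]] takes its norm in [R[i]], hence the embedding of the real value. *)
Let nrm (x : V) : R[i] := (ces_fine x)%:C.

Let nrmD (x y : V) : nrm (x + y) <= nrm x + nrm y.
Proof. by rewrite -rmorphD lecR ces_fineD. Qed.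

Let nrmZ (c : R[i]) (x : V) : nrm (c *: x) = `|c| * nrm x.
Proof. by rewrite /nrm ces_fineZ rmorphM. Qed.

Let nrm_eq0 (x : V) : nrm x = 0 -> x = 0.
Proof.
move=> /eqP; rewrite eq_complex/= eqxx andbT => /eqP x0.
apply/val_inj/funext => n /=; apply: Normc.eq0_normc; apply/eqP.
by rewrite eq_le normc_ge0 andbT; have := ces_space_coef x n; rewrite x0 mulr0.
Qed.

HB.instance Definition _ :=
  Lmodule_isNormed.Build R[i] V nrmD nrmZ nrm_eq0.

End ces_banach.

(** * Completeness of ces_p *)

Section ces_complete.
Variables (R : realType) (p : R) (p1 : 1 < p).
Local Notation V := (ces_space p1).

Let p0 : 0 < p. Proof. exact: lt_trans ltr01 p1. Qed.

Lemma normr_cesE (x : V) : `|x| = (ces_fine x)%:C.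
Proof. by []. Qed.

Lemma ball_ces (x y : V) (e : R) : ball x e%:C y = (ces_fine (x - y) < e) :>
  Prop.
Proof. by rewrite -ball_normE /ball_/= normr_cesE ltcR. Qed.

(** The n-th coefficient is Lipschitz with constant n + 1, so its real and imaginary parts are
    Cauchy in R. *)
Lemma cauchy_ces_coef (F : set_system V) n : ProperFilter F -> cauchy F ->
  exists z : R[i], (fun x : V => x n) @ F --> z.
Proof.
move=> FF /cauchyP F_cauchy.
have part (f : R[i] -> R) : (forall z w, f (z - w) = f z - f w) ->
    (forall z, `|f z| <= normc z) -> cvg ((fun x : V => f (x n)) @ F).
  move=> fB fz; apply: R_complete; apply/cauchyP => e e0.
  have d0 : 0 < (e / n.+1%:R)%:C :> R[i] by rewrite ltcR divr_gt0.
  have [x Fx] := F_cauchy _ d0; exists (f (x n)).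
  suff : \forall y \near F, ball (f (x n)) e (f ((y : V) n)) by [].
  move: Fx; apply: filterS => y; rewrite ball_ces ltr_pdivlMr// mulrC => xy.
  rewrite -ball_normE /ball_/= -fB (le_lt_trans (fz _))//.
  by apply: le_lt_trans xy; exact: (ces_space_coef (x - y) n).
have /cvg_ex[a Fa] := part _ (@ReB R) (@normc_ge_absRe R).
have /cvg_ex[b Fb] := part _ (@ImB R) (@normc_ge_absIm R).
by exists (a +i* b); exact: cvg_complex.
Qed.

(* Each mean of [x - y] tends to the mean of [x - l], and so is eventually at
   least half of it. *)
Lemma ces_norm_limit (F : set_system V) (l : nat -> R[i]) (x : V) (e : R) :
  ProperFilter F -> 0 <= e -> (forall n, (fun y : V => y n) @ F --> l n) ->
  (\forall y \near F, ces_fine (x - y) <= e) ->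
  (ces_norm p ((x : nat -> R[i]) - l)%R <= (2 * e)%:E)%E.
Proof.
move=> FF e0 Fl Fx; apply/ces_norm_leP => //; first by rewrite mulr_ge0.
move=> N.
have half (n : nat) : \forall y \near F,
    ces_mean ((x : nat -> R[i]) - l) n <= 2 * ces_mean (x - y : V) n.
  pose m := ces_mean ((x : nat -> R[i]) - l) n.
  have [m0|m0] := leP m 0.
    by apply: nearW => y; rewrite (le_trans m0)// mulr_ge0// ces_mean_ge0.
  have Fk : \forall y \near F, forall k : 'I_n.+1, normc (l k - (y : V) k) < m /
    2.
    apply: filter_forall => k.
    have /cvg_normcP := Fl k; apply; exact: divr_gt0.
  move: Fk; apply: filterS => y yk.
  have : ces_mean ((y : nat -> R[i]) - l) n <= m / 2.
    rewrite /ces_mean mulrC ler_pdivrMr// mulr_natr.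
    rewrite -[n.+1 in leRHS]card_ord -sumr_const ler_sum// => k _.
    by have /ltW := yk k; rewrite normcB.
  (* Here m is at most the mean of x - y plus m/2, and the m/2 is absorbed on the left. *)
  have := ces_meanD (x - y : V) ((y : nat -> R[i]) - l) n.
  have -> : ((x - y : V) : nat -> R[i]) + ((y : nat -> R[i]) - l) = (x : nat ->
    R[i]) - l.
    by apply/funext => k; exact: (subrKA (y k) (x k) (- l k)).
  by rewrite -/m; lra.
(* Only N means enter the partial sum, so a single y satisfies all the eventual conditions at
   once. *)
have [y [xy yh]] : exists y : V, ces_fine (x - y) <= e /\
    forall n : 'I_N, ces_mean ((x : nat -> R[i]) - l) n <= 2 * ces_mean (x - y :
      V) n.
  apply: (@filter_ex _ F); apply: filterI => //.
  by apply: filter_forall => n; exact: half.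
apply: (@le_trans _ _ (2 `^ p * \sum_(n < N) ces_mean (x - y : V) n `^ p)).
  rewrite mulr_sumr ler_sum// => n _; rewrite -powRM ?ces_mean_ge0//.
  apply: ge0_ler_powR; rewrite ?nnegrE ?ces_mean_ge0 ?(ltW p0)//.
  by rewrite mulr_ge0 ?ces_mean_ge0.
rewrite powRM// ler_wpM2l ?powR_ge0//.
by apply: (ces_norm_leP (x - y : V) p0 e0).1; rewrite ces_fineE lee_fin.
Qed.

(** The limit is the coefficientwise one, [l]. It belongs to the space as x - (x - l), where
    [ces_norm_limit] makes the norm of x - l finite; the same bound gives convergence in norm. *)
Lemma ces_complete (F : set_system V) : ProperFilter F -> cauchy F -> cvg F.
Proof.
move=> FF F_cauchy.
have /choice[l Fl] n : exists z : R[i], (fun x : V => x n) @ F --> z.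
  exact: cauchy_ces_coef.
move/cauchyP : F_cauchy => F_cauchy.
have near_l e : 0 < e -> exists x : V, (\forall y \near F, ces_fine (x - y) < e)
  /\
    (ces_norm p ((x : nat -> R[i]) - l)%R <= (2 * e)%:E)%E.
  move=> e0; have e0C : 0 < e%:C :> R[i] by rewrite ltcR.
  have [x Fx] := F_cauchy _ e0C.
  have {}Fx : \forall y \near F, ces_fine (x - y) < e.
    by move: Fx; apply: filterS => y; rewrite ball_ces.
  exists x; split=> //; apply: (@ces_norm_limit F) => //; first exact: ltW.
  by move: Fx; apply: filterS => y /ltW.
have lp : l \in ces_pred p1.
  have [x [_ xl]] := near_l _ ltr01.
  have -> : l = (x : nat -> R[i]) - ((x : nat -> R[i]) - l) by rewrite opprB
    addrC subrK.
  apply: rpredB; first exact: valP.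
  by apply/ces_predP; rewrite /ces/= (le_lt_trans xl)// ltry.
apply/cvg_ex; exists (CesSpace lp); apply/cvgrPdist_lt => e e0.
have /andP[/eqP Im0 Re0] : (complex.Im e == 0) && (0 < complex.Re e).
  by move: e0; rewrite ltcE /=.
(* Two thirds go to the distance from [l] to x, where [near_l] loses a factor 2, and one third to
   that from x to y. *)
have d0 : 0 < complex.Re e / 3 by rewrite divr_gt0.
have [x [Fx xl]] := near_l _ d0.
move: Fx; apply: filterS => y xy.
have -> : e = (complex.Re e)%:C by case: e Im0 {e0 Re0 d0 xl xy} => a b /= ->.
rewrite normr_cesE ltcR -(subrKA x).
apply: le_lt_trans (ces_fineD _ _) _.
have : ces_fine (CesSpace lp - x) <= 2 * (complex.Re e / 3).
  rewrite -[_ - x]opprB -scaleN1r ces_fineZ normcN Normc.normc1 mul1r.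
  by rewrite -lee_fin -ces_fineE.
by move: xy; lra.
Qed.

HB.instance Definition _ := Uniform_isComplete.Build V ces_complete.

End ces_complete.

(** * Uniqueness and analyticity *)

Section dirichlet_functions.
Variable R : realType.
Implicit Types (a b : nat -> R[i]) (s z w : R[i]) (x : R).

Lemma cexpD z w : cexp (z + w) = cexp z * cexp w.
Proof.
case: z w => x1 y1 [x2 y2]; rewrite /cexp/= expRD cosD sinD rmorphM.
rewrite mulrACA; congr (_ * _).
by simpc; congr (_ +i* _); rewrite addrC.
Qed.

Lemma dirichlet_term_shift a z w n :
  dirichlet_term a w n =
    dirichlet_term a z n * cexp (- (w - z) * (ln (n.+1%:R : R))%:C).
Proof.
rewrite /dirichlet_term -mulrA -cexpD; congr (_ * cexp _).
by move: (ln _)%:C => L; ring.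
Qed.

(** By strong induction the terms before n vanish. At s = x + j the n-th term then cancels against
    the later ones, which are smaller by a further power ((n+1)/(n+2))^j; letting j grow leaves
    [b n <= 0]. *)
Lemma dirichlet_uniqueness a x M :
  (forall N, \sum_(n < N) normc (a n) * n.+1%:R `^ (- x) <= M) ->
  (forall j : nat,
     series (dirichlet_term a (x + j%:R)%:C) @ \oo --> (0 : R[i])) ->
  forall n, a n = 0.
Proof.
move=> aM a0 n; elim/ltn_ind: n => n IH; apply: Normc.eq0_normc.
pose b k := normc (a k) * k.+1%:R `^ (- x).
have b0 k : 0 <= b k by rewrite mulr_ge0 ?normc_ge0 ?powR_ge0.
have termE j k : normc (dirichlet_term a (x + j%:R)%:C k) = b k / k.+1%:R ^+ j.
  rewrite normc_dirichlet_term/= opprD powRD ?pnatr_eq0 ?implybT// mulrA.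
  by rewrite (powRN _ j%:R) powR_mulrn.
have M0 : 0 <= M by have := aM 0%N; rewrite big_ord0.
have bound j : b n / n.+1%:R ^+ j <= M / n.+2%:R ^+ j.
  apply/ler_addgt0Pr => e e0.
  (* A partial sum within e of 0 that contains index n is split into the n-th term [t] and the rest
     [S]. *)
  have [N HN] := cvg_series_normc (a0 j) e0.
  have := HN _ (leq_maxl N n.+1); set m := maxn N n.+1.
  have nm : (n < m)%N by rewrite leq_maxr.
  rewrite sub0r normcN -(big_mkord xpredT (dirichlet_term a _)).
  rewrite (big_cat_nat (leq0n n) (ltnW nm))/= big_nat_cond big1 => [|k];
    last first.
    by rewrite andbT => /andP[_ kn]; rewrite /dirichlet_term IH// mul0r.
  rewrite add0r (big_ltn nm); set t := dirichlet_term _ _ n;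
    set S := \sum_(_ <= _ < _) _.
  move=> tS; have SM : normc S <= M / n.+2%:R ^+ j.
    apply: le_trans (normc_sum _ _ _) _.
    apply: le_trans (_ : \sum_(n.+1 <= k < m) b k / n.+2%:R ^+ j <= _).
      apply: ler_sum_nat => k /andP[nk km]; rewrite termE ler_wpM2l//.
      by rewrite lef_pV2 ?posrE ?exprn_gt0 ?ltr0n// lerXn2r ?nnegrE// ler_nat.
    rewrite -mulr_suml ler_wpM2r ?invr_ge0 ?exprn_ge0//.
    apply: le_trans (aM m); rewrite -(big_mkord xpredT b).
    by rewrite (big_cat_nat (leq0n _) nm)/= lerDr sumr_ge0.
  rewrite -termE -/t -(addrK S t); apply: le_trans (normcD _ _) _.
  by rewrite normcN addrC lerD// ltW.
have bn0 : b n <= 0.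
  have geo : (fun j => M * (n.+1%:R / n.+2%:R) ^+ j) @ \oo --> (0 : R).
    apply: (@cvg_geometric R M (n.+1%:R / n.+2%:R)).
    by rewrite ger0_norm ?divr_ge0// ltr_pdivrMr ?ltr0n// mul1r ltr_nat.
  apply: (cvgr_to_ge geo).
  apply: nearW => j; have := bound j.
  by rewrite ler_pdivrMr ?exprn_gt0 ?ltr0n// expr_div_n mulrAC mulrA.
apply/eqP; rewrite eq_le normc_ge0 andbT.
by rewrite -(pmulr_lle0 _ (powR_gt0 (- x) (ltr0Sn R n))).
Qed.

Lemma dirichlet_analytic a sigma :
  (forall x : R, sigma < x ->
    exists M, forall N, \sum_(n < N) normc (a n) * n.+1%:R `^ (- x) <= M) ->
  analytic_on (half_plane sigma)
    (patch (fun=> 0) (half_plane sigma) (dirichlet_sum a)).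
Proof.
(* Half the distance to the boundary: the series still converges absolutely at abscissa Re z - d,
   which leaves a spare factor (n+1)^d. *)
move=> a_abs z zO; pose d := (complex.Re z - sigma) / 2.
have d0 : 0 < d by rewrite divr_gt0// subr_gt0.
have [M aM] : exists M, forall N,
    \sum_(n < N) normc (a n) * n.+1%:R `^ (- (complex.Re z - d)) <= M.
  by apply: a_abs; rewrite /d; move: zO; rewrite /half_plane/=; lra.
pose L n : R := ln n.+1%:R.
have L0 n : 0 <= L n by rewrite ln_ge0// ler1n.
have expL n (e : R) : expR (e * L n) = n.+1%:R `^ e by rewrite /powR pnatr_eq0.
(* A single term of the exponential series of d ln(n+1) is at most its sum (n+1)^d. *)
have expL_term n k : (d * L n) ^+ k / k`!%:R <= n.+1%:R `^ d.
  have dL0 : 0 <= d * L n by rewrite mulr_ge0// ltW.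
  have := normc_exp_sum_le (d * L n)%:C k.+1.
  rewrite normc_real ger0_norm// expL; apply: le_trans.
  rewrite big_ord_recr/= normc_exp_term normc_real ger0_norm// lerDr sumr_ge0//
    => i _.
  exact: normc_ge0.
have powz n : n.+1%:R `^ (- (complex.Re z - d)) =
    n.+1%:R `^ (- complex.Re z) * n.+1%:R `^ d.
  by rewrite opprB addrC powRD// pnatr_eq0 implybT.
(* Summed over n this gives the k-th Taylor coefficient at z, the k-th derivative divided by the
   factorial of k. *)
pose v k n := dirichlet_term a z n * ((- (L n)%:C) ^+ k / k`!%:R).
have v_cvg k : cvgn (series (v k)).
  apply: (@normc_series_cvg _ _ (M / d ^+ k)) => N.
  rewrite ler_pdivlMr ?exprn_gt0// mulr_suml; apply: le_trans (aM N).
  apply: ler_sum => n _; rewrite Normc.normcM normc_dirichlet_term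
    normc_exp_term.
  rewrite normcN normc_real ger0_norm// powz.
  rewrite -!mulrA ler_wpM2l ?normc_ge0// ler_wpM2l ?powR_ge0//.
  by rewrite mulrA mulrAC -exprMn [L n * d]mulrC.
exists (fun k => limn (series (v k))).
have : \forall w \near z, normc (z - w) < d.
  by have /cvg_normcP := @cvg_id _ (nbhs z); apply.
apply: filterS => w wz.
have wO : half_plane sigma w.
  have := normc_ge_absRe (z - w); rewrite ReB => /(le_lt_trans)/(_ wz).
  by rewrite ltr_norml => /andP[_]; move: zO; rewrite /half_plane/= /d; lra.
rewrite patchT ?inE//.
pose u n k := dirichlet_term a z n * ((- (w - z) * (L n)%:C) ^+ k / k`!%:R).
have uv n k : u n k = v k n * (w - z) ^+ k.
  rewrite /u /v (_ : - (w - z) * _ = - (L n)%:C * (w - z)).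
    by rewrite exprMn [_ * _ / _]mulrAC mulrA.
  by rewrite !mulNr mulrC.
(* Row n sums over k to the n-th Dirichlet term at w, column k sums over n to the k-th term of the
   power series. The bound [M] holds since exp(|w-z| ln(n+1)) <= (n+1)^d. *)
apply: (@series_exchange _ u (dirichlet_term a w) _ M).
- move=> N K; apply: le_trans (aM N); apply: ler_sum => n _.
  under eq_bigr do rewrite Normc.normcM.
  rewrite -mulr_sumr normc_dirichlet_term powz.
  rewrite -mulrA ler_wpM2l ?normc_ge0// ler_wpM2l ?powR_ge0//.
  apply: le_trans (normc_exp_sum_le _ _) _.
  rewrite -expL ler_expR Normc.normcM normcN normc_real ger0_norm//.
  by rewrite ler_wpM2r// normcB ltW.
- move=> n; rewrite (dirichlet_term_shift _ z).
  rewrite (_ : series _ = fun K => dirichlet_term a z n *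
    series (fun k => (- (w - z) * (L n)%:C) ^+ k / k`!%:R) K).
    by apply: cvgM; [exact: cvg_cst | exact: series_cexp].
  by apply/funext => K; rewrite /series/= mulr_sumr.
- move=> k; rewrite (_ : series _ = fun N => series (v k) N * (w - z) ^+ k).
    by apply: cvgM; [exact: v_cvg | exact: cvg_cst].
  by apply/funext => N; rewrite /series/= mulr_suml; apply: eq_bigr => n _.
have [M' aM'] := a_abs _ wO.
have : cvgn (series (dirichlet_term a w)).
  by apply: (normc_series_cvg (M := M')) => N;
    under eq_bigr do rewrite normc_dirichlet_term.
exact.
Qed.

End dirichlet_functions.

(** * The elements of ces_p as functions on the half-plane *)

Section ces_functions.
Variables (R : realType) (p : R) (p1 : 1 < p).
Local Notation V := (ces_space p1).
Local Notation Omega := (half_plane (1 - p^-1)).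

Definition ces_function (x : V) : R[i] -> R[i] :=
  patch (fun=> 0) Omega (dirichlet_sum x).

Let dirichlet_sum_cvg (x : V) s : Omega s ->
  series (dirichlet_term x s) @ \oo --> dirichlet_sum x s.
Proof.
move=> sO; have [xs _] := ces_dirichlet_cvg p1 (ces_valP x) sO.
exact: xs.
Qed.

Lemma ces_function_linear : linear ces_function.
Proof.
move=> c x y; apply/funext => s.
change (ces_function (c *: x + y) s = c * ces_function x s + ces_function y s).
rewrite /ces_function /patch; case: ifPn => [|_]; last by rewrite mulr0 addr0.
rewrite inE => sO; apply/cvg_lim => //.
rewrite (_ : series _ = fun n => c * series (dirichlet_term x s) n +
    series (dirichlet_term y s) n).
  apply: cvgD; last exact: dirichlet_sum_cvg.
  by apply: cvgM; [exact: cvg_cst | exact: dirichlet_sum_cvg].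
apply/funext => n; rewrite /series/= mulr_sumr -big_split;
  apply: eq_bigr => k _.
transitivity ((c * x k + y k) * cexp (- s * (ln (k.+1%:R : R))%:C));
  first by [].
by rewrite mulrDl -mulrA.
Qed.

HB.instance Definition _ :=
  GRing.isLinear.Build R[i] V (R[i] -> R[i]) _ ces_function ces_function_linear.

Lemma ces_function_inj : injective ces_function.
Proof.
apply: raddf_inj => x x0; apply/val_inj/funext => n /=.
(* The uniqueness lemma is applied at the points 1 + j, which all lie in the half-plane; j = 0
   provides the absolute bound. *)
have O1 (j : nat) : 1 - p^-1 < 1 + j%:R.
  by rewrite ltrD2l (lt_le_trans _ (ler0n _ _))// oppr_lt0 invr_gt0 (lt_trans _
    p1).
have [M xM] := ces_dirichlet_bound p1 (ces_valP x) (O1 0%N).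
apply: (dirichlet_uniqueness xM) => j; rewrite addr0.
have sO : Omega (1 + j%:R)%:C by exact: O1.
have x0s : dirichlet_sum x (1 + j%:R)%:C = 0.
  transitivity (ces_function x (1 + j%:R)%:C); last by rewrite x0.
  by rewrite /ces_function patchT ?inE.
by rewrite -x0s; exact: dirichlet_sum_cvg.
Qed.

End ces_functions.

(** The mode of convergence [C] is arbitrary so as to serve both abscissas. A series that fails at a
    real t > theta - e admits no sigma below theta - e, so its abscissa is at least theta - e. *)
Lemma abscissa_sup (R : realType) (E : set (nat -> R[i]))
    (C : (nat -> R[i]) -> R[i] -> Prop) (theta : R) :
  (forall a, E a -> forall s, half_plane theta s -> C a s) ->
  (forall sigma, sigma < theta -> exists2 t : R, sigma < t &
    exists2 a, E a & ~ C a t%:C) ->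
  ereal_sup [set ereal_inf [set sigma%:E | sigma in
    [set sigma : R | forall s, half_plane sigma s -> C a s]] | a in E]
  = theta%:E.
Proof.
move=> EC sharp; apply/eqP; rewrite eq_le; apply/andP; split.
  apply: ge_ereal_sup => _ [a aE <-].
  by apply: ereal_inf_lbound; exists theta => //; exact: EC.
apply/lee_addgt0Pr => e e0; rewrite -leeBlDr// -EFinB.
have [|t et [a aE aC]] := sharp (theta - e); first by rewrite gtrBl.
apply: le_trans (_ : ereal_inf [set sigma%:E | sigma in
    [set sigma : R | forall s, half_plane sigma s -> C a s]] <= _)%E;
      last first.
  by apply: ereal_sup_ubound; exists a.
apply: le_ereal_inf_tmp => _ [sigma Cs <-]; rewrite lee_fin leNgt.
by apply/negP => se; apply: aC; apply: Cs; exact: lt_trans se et.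
Qed.

Theorem theorem3p3 (R : realType) (p q : R) (p_gt1 : 1 < p)
    (pq : p^-1 + q^-1 = 1) :
  [/\ forall a, ces p a -> forall s, half_plane q^-1 s ->
        dirichlet_cvg a s /\ dirichlet_abs_cvg a s,
      space_sigma_c (ces p) = (q^-1)%:E /\ space_sigma_a (ces p) = (q^-1)%:E,
      banach_space_of_analytic_functions
        (half_plane q^-1) (ces p) (ces_norm p) &
      forall sigma : R, sigma < q^-1 ->
        ~ (forall a, ces p a ->
             forall s, half_plane sigma s -> dirichlet_cvg a s)].
Proof.
have -> : q^-1 = 1 - p^-1 by rewrite -pq addrAC subrr add0r.
have y0 : 0 < 1 - p^-1 by rewrite subr_gt0 invf_lt1// (lt_trans _ p_gt1).
have cvg_p a : ces p a -> forall s, half_plane (1 - p^-1) s ->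
    dirichlet_cvg a s /\ dirichlet_abs_cvg a s.
  by move=> ap s; exact: ces_dirichlet_cvg.
have sharp (sigma : R) : sigma < 1 - p^-1 -> exists2 t : R, sigma < t &
    exists a, [/\ ces p a, ~ dirichlet_cvg a t%:C & ~ dirichlet_abs_cvg a t%:C].
  (* The lacunary series needs a positive exponent, so t is the midpoint between 1 - 1/p and the
     larger of sigma and 0. *)
  move=> sp; have mp : Num.max sigma 0 < 1 - p^-1 by rewrite gt_max sp.
  have [mt tp] := midf_lt mp.
  exists ((Num.max sigma 0 + (1 - p^-1)) / 2).
    by apply: le_lt_trans mt; rewrite le_max lexx.
  exists (lacunary_coef ((Num.max sigma 0 + (1 - p^-1)) / 2)); split.
  - by apply: lacunary_ces => //; apply: le_lt_trans mt;
    rewrite le_max lexx orbT.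
  - exact: lacunary_dvg.
  - exact: lacunary_abs_dvg.
split=> //.
- split; apply: abscissa_sup.
  + by move=> a ap s /(cvg_p _ ap)[].
  + by move=> sigma /sharp[t st [a [ap ? _]]]; exists t => //; exists a.
  + by move=> a ap s /(cvg_p _ ap)[].
  + by move=> sigma /sharp[t st [a [ap _ ?]]]; exists t => //; exists a.
- exists (ces_space p_gt1), (\val : {linear ces_space p_gt1 -> (nat -> R[i])}),
    (@ces_function R p p_gt1 : {linear ces_space p_gt1 -> (R[i] -> R[i])}).
  split.
  + exact: val_inj.
  + apply/seteqP; split=> [_ [x _ <-]|a ap]; first exact: ces_valP.
    by have /ces_predP ap' := ap; exists (CesSpace (ap' p_gt1)).
  + exact: ces_fineE.
  + exact: ces_function_inj.
  + move=> x; split=> //; apply: dirichlet_analytic => t pt.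
    exact: ces_dirichlet_bound (ces_valP x) pt.
- move=> sigma /sharp[t st [a [ap at_dvg _]]] /(_ a ap t%:C st).
  exact: at_dvg.
Qed.
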